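(* Let $C$ be a field that is complete with respect to a non-archimedean absolute value $|\cdot|$, and assume $|3| = 1$. Let $f(t) = t^3 + pt + q \in C[t]$, with discriminant $\Delta = -4p^3 - 27q^2$. (a) The polynomial $f$ has a shortest root if and only if $(p,q) \in D_{\mathrm{tri}}$. In that case the shortest root is the trinomial root, of length $|q|/|p| < |p|^{1/2}$, while the other two roots have length $|p|^{1/2}$. (b) If there is no shortest root, then all three roots have the common length $|q|^{1/3}$. (c) The polynomial $f$ has an isolated root if and only if $(p,q) \in D_{\mathrm{disc}}$. In that case the isolated root is the discriminant root; it lies at distance $|p|^{1/2}$ from each of the other two roots, which are at mutual distance $|\Delta|^{1/2}/|p| < |p|^{1/2}$. (d) If there is no isolated root, then the three pairwise distances between the roots are equal, to $|p|^{1/2}$ if $(p,q) \in D_{\mathrm{tri}}$ and to $|q|^{1/3}$ otherwise. (e) If $|2| = 1$, then $f$ can have an isolated root or a shortest root, but not both. (f) If $|2| < 1$, then a shortest root exists if and only if an isolated root exists. In that case, the shortest root, the isolated root, the discriminant root, and the trinomial root are all equal.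
   Context: An absolute value is non-archimedean if $|n\cdot 1_C| \le 1$ for all $n \in \mathbb{Z}$ (equivalently, it satisfies the ultrametric inequality). Since $C$ is complete, $|\cdot|$ extends uniquely to an algebraic closure of $C$; the three roots $x_1,x_2,x_3$ of $f$ (with multiplicity) are taken there. The length of a root $x$ is $|x|$, and the distance between roots $x,x'$ is $|x-x'|$. Shortest and isolated roots: since $x_1+x_2+x_3=0$, either all three roots have the same length, or two have equal length and the third is strictly shorter; in the latter case that third root is called the shortest root (otherwise there is no shortest root). Likewise, among the three differences $x_1-x_2$, $x_2-x_3$, $x_3-x_1$, either all have the same length, or exactly one is strictly shorter than the other two (which have equal length); in the latter case the root not involved in the strictly shortest difference is called the isolated root (otherwise there is no isolated root). Domains: $D_{\mathrm{tri}} := \{(p,q) \in C^2 : |q|^2 < |p|^3\}$ and $D_{\mathrm{disc}} := \{(p,q) \in C^2 : |\Delta| < |3p|^3\}$ with $\Delta = -4p^3-27q^2$. In both sets $p \ne 0$. Trinomial root: let $\mathcal{B}_3(z) = \sum_{m\ge 0} \frac{1}{3m+1}\binom{3m+1}{m} z^m \in \mathbb{Z}[[z]]$. For $(p,q) \in D_{\mathrm{tri}}$ the series $\mathcal{B}_3\left(q^2/(-p)^3\right)$ converges (unconditionally) to some $\mu \in C$, and the trinomial root is $-q\mu/p$ (it is a root of $f$). Discriminant root: for $(p,q) \in D_{\mathrm{disc}}$ the series $\sum_{n\ge 0}\binom{3n}{n}\left(\frac{-\Delta}{27p^3}\right)^n$ converges (unconditionally) to some $\lambda \in C$, and the discriminant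 root is $\frac{3q}{p}\lambda$; in particular it is $0$ when $q = 0$. *)

(* Defs.v *)
From HB Require Import structures.
From mathcomp Require Import all_boot all_order all_algebra finmap.
From mathcomp Require Import all_classical all_reals all_analysis.
From mathcomp Require Import summability.
From mathcomp Require Import zify.

Set Implicit Arguments.
Unset Strict Implicit.
Unset Printing Implicit Defensive.
Import Order.TTheory GRing.Theory Num.Theory numFieldNormedType.Exports.
Local Open Scope classical_set_scope.
Local Open Scope ring_scope.

(* The library's [normedZmodType] cannot be used for absolute values on a
   field: its axiom `|x *+ n| = `|x| *+ n rules out non-archimedean ones. *)
Record absval (R : realType) (F : fieldType) := AbsVal {
  absval_fun :> F -> R;
  absval_ge0 : forall x, 0 <= absval_fun x;
  absval_eq0 : forall x, absval_fun x = 0 <-> x = 0;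
  absvalM : forall x y, absval_fun (x * y) = absval_fun x * absval_fun y;
  absvalD : forall x y, absval_fun (x + y) <= absval_fun x + absval_fun y }.

Definition nonarchimedean (R : realType) (F : fieldType) (v : absval R F) :=
  forall n : int, v n%:~R <= 1.

Definition absval_complete (R : realType) (F : fieldType) (v : absval R F) :=
  forall u : nat -> F,
    (forall e : R, 0 < e ->
       exists N, forall m n, (N <= m)%N -> (N <= n)%N -> v (u m - u n) < e) ->
    exists l : F, (fun n => v (u n - l)) @ \oo --> (0 : R).

(* Unconditional convergence of [\sum_n a n] to [l]: [totally] is the filter of
   finite sets of indices directed by inclusion. *)
Definition unconditional_sum (R : realType) (F : fieldType) (v : absval R F)
    (a : nat -> F) (l : F) :=
  (fun A : {fset nat} => v (\sum_(i <- A) a i - l)) @ totally --> (0 : R).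

Definition algebraic_closure (F : fieldType) (K : closedFieldType)
    (iota : {rmorphism F -> K}) :=
  forall z : K, algebraicOver iota z.

Section Cubic.
Context {R : realType} {C : fieldType}.
Implicit Types (v : absval R C) (p q r : C).

Definition cubic p q : {poly C} := 'X^3 + p *: 'X + q%:P.

Definition cubic_disc p q : C := - (4 * p ^+ 3) - 27 * q ^+ 2.

Definition roots_of_cubic (K : closedFieldType) (iota : {rmorphism C -> K})
    p q (x : 'I_3 -> K) :=
  map_poly iota (cubic p q) = \prod_(i < 3) ('X - (x i)%:P).

Definition D_tri v : set (C * C) :=
  [set pq | v pq.2 ^+ 2 < v pq.1 ^+ 3].

Definition D_disc v : set (C * C) :=
  [set pq | v (cubic_disc pq.1 pq.2) < v (3 * pq.1) ^+ 3].

(* The division is carried out, exactly, in nat (see [dvdn_B3_coef]) before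
   casting to C, because 3m+1 may vanish in C. *)
Definition B3_coef (m : nat) : nat := ('C((3 * m).+1, m) %/ (3 * m).+1)%N.

Lemma dvdn_B3_coef m : ((3 * m).+1 %| 'C((3 * m).+1, m))%N.
Proof.
have cop : coprime (3 * m).+1 ((3 * m).+1 - m).
  have -> : ((3 * m).+1 - m)%N = (2 * m).+1 by lia.
  by rewrite coprime_sym; apply/coprimeP => //; exists (3, 2)%N => /=; lia.
by rewrite -(Gauss_dvdr _ cop) -mul_bin_down dvdn_mulr.
Qed.

Definition is_trinomial_root v p q r :=
  D_tri v (p, q) /\
  exists2 mu : C,
    unconditional_sum v
      (fun m => (B3_coef m)%:R * (q ^+ 2 / (- p) ^+ 3) ^+ m) mu
    & r = - (q * mu) / p.

Definition is_discriminant_root v p q r :=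
  D_disc v (p, q) /\
  exists2 lambda : C,
    unconditional_sum v
      (fun n => 'C(3 * n, n)%:R * (- cubic_disc p q / (27 * p ^+ 3)) ^+ n)
      lambda
    & r = 3 * q / p * lambda.

End Cubic.

Section Roots.
Context {R : realType} {K : fieldType} (w : absval R K) (x : 'I_3 -> K).

Definition shortest_root (i : 'I_3) :=
  forall j k : 'I_3, i != j -> i != k -> j != k ->
    w (x j) = w (x k) /\ w (x i) < w (x j).

Definition isolated_root (i : 'I_3) :=
  forall j k : 'I_3, i != j -> i != k -> j != k ->
    w (x i - x j) = w (x i - x k) /\ w (x j - x k) < w (x i - x j).

Definition has_shortest_root := exists i, shortest_root i.
Definition has_isolated_root := exists i, isolated_root i.

End Roots.

(* Main.v *)
Require Import Defs.
From HB Require Import structures.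
From mathcomp Require Import all_boot all_order all_algebra finmap.
From mathcomp Require Import all_classical all_reals all_analysis.
From mathcomp Require Import summability.
From mathcomp Require Import zify ring lra.

Set Implicit Arguments.
Unset Strict Implicit.
Unset Printing Implicit Defensive.
Import Order.TTheory GRing.Theory Num.Theory numFieldNormedType.Exports.

(** The argument has two independent halves.

    Lengths.  Three elements of sum zero in an ultrametric field have
    either equal lengths or one strictly shorter than the other two
    ([shortest_or_equal]).  If [a] is shortest and [b], [c] have length [B],
    then [p = bc - a^2] has length [B^2] and [q = -abc] has length [|a| B^2],
    so [|q|^2 < |p|^3]; if the three lengths are equal to [A] then
    [|q| = A^3] and [|p| <= A^2], so the inequality fails.  Everything about
    lengths follows.  The differences of the roots again have sum zero: they
    are the roots of [t^3 + 3 p t + s] with [s^2] the discriminant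
    ([sides_of_cubic]), and an isolated root is exactly one whose opposite
    difference is a shortest root of this second cubic
    ([isolated_root_side]).  Hence the statements about distances are the
    statements about lengths applied to another cubic.

    Series.  Let [B] be the generating function of the coefficients
    [B3_coef] and [S] that of the binomials [C(3n, n)].  Their convolution
    identities give [B = 1 + y B^3] and [S (3 - 2 B) = B], whence
    [(4 - 27 y) S^3 = 3 S + 1].  The two cubic equations say precisely that
    the trinomial and discriminant expressions are roots of [f]
    ([trinomial_root_exists], [discriminant_root_exists]).

    The two halves meet as follows.  The trinomial root has length
    [|q| / |p|], which only the shortest root has
    ([shortest_root_trinomial]).  The discriminant root differs from
    [3 q / p] by less than the distance [d] from the isolated root [a] to the
    others, and [3 q / p - a = a (b - c)^2 / p] is shorter than [d] too, so
    the discriminant root can only be [a] ([isolated_root_discriminant]).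

    Finally, if [a] is shortest then [b - c = 2 b + a], and in general
    [3 a = 2 (a - b) + (b - c)]: when [|2| = 1] the first identity makes all
    three distances equal, and when [|2| < 1] the two identities show that
    shortest and isolated mean the same. *)

(** * Convolution identities for ternary binomial coefficients *)

(** The coefficient of [y^n] in [B(y)^a], also given by
    [a / (a + 3 n) * C(a + 3 n, n)].  The recursion is the telescoped form of
    [B^(i+1) - B^i = y B^(i+3)], a consequence of [B = 1 + y B^3]; it stays
    in [nat] and turns the identities below into inductions. *)
Fixpoint raney (n a : nat) : nat :=
  if n is m.+1 then \sum_(i < a) raney m i.+3 else 1.

Lemma raney0r n : raney n.+1 0 = 0.
Proof. by rewrite /= big_ord0. Qed.

Lemma raneySS n a : raney n.+1 a.+1 = raney n.+1 a + raney n a.+3.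
Proof. by rewrite /= big_ord_recr. Qed.

(** The induction step amounts to
    [(n+1) C(N, n+1) = (N - n) C(N, n)] with [N = a + 3 (n+1)]. *)
Lemma raney_closed n a : (a + 3 * n) * raney n a = a * 'C(a + 3 * n, n).
Proof.
elim: n a => [|n IHn] a; first by rewrite muln0 addn0 bin0.
elim: a => [|a IHa]; first by rewrite raney0r !muln0.
have := IHn a.+3; rewrite (_ : a.+3 + 3 * n = a + 3 * n.+1); last by lia.
move: IHa; rewrite raneySS addSn binS.
have := mul_bin_left (a + 3 * n.+1) n.
set N := a + _ => hbin hA hB.
apply/eqP; rewrite -(@eqn_pmul2l N); last by rewrite /N; lia.
have hN : N = a + 3 * n.+1 by [].
have hbin' : n.+1 * 'C(N, n.+1) = (a + 2 * n + 3) * 'C(N, n).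
  by rewrite hbin; congr (_ * _); lia.
move: hA hB hbin'; move: (raney _ _) (raney _ _) 'C(_, _) 'C(_, _).
move=> r s c d hA hB hc.
apply/eqP.
rewrite mulnCA mulnDr hA hB.
suff: 3 * (n.+1 * d) = 3 * (a + 2 * n + 3) * c by rewrite hN; nia.
by rewrite hc mulnA.
Qed.

(** Any family obeying the recursion of [B^b H], for some fixed series [H],
    is multiplied by [B^a] as expected; [H = 1] gives the powers of [B] and
    [H = S] gives the numbers [C(b + 3 n, n)]. *)
Lemma raney_conv (G : nat -> nat -> nat) :
  (forall b, G 0 b.+1 = G 0 b) ->
  (forall n b, G n.+1 b.+1 = G n.+1 b + G n b.+3) ->
  forall n a b, \sum_(i < n.+1) raney i a * G (n - i) b = G n (a + b).
Proof.
move=> G0 GS; elim=> [|n IHn] a b.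
  rewrite big_ord1 mul1n.
  by elim: a => [|a IHa] //; rewrite addSn G0.
elim: a => [|a IHa].
  rewrite big_ord_recl mul1n subn0 big1 ?addn0 // => i _.
  by rewrite raney0r.
rewrite addSn GS -IHa -(IHn a.+3 b) [LHS]big_ord_recl.
rewrite [X in _ = X + _]big_ord_recl -addnA -big_split /=; congr (_ + _).
by apply: eq_bigr => i _; rewrite /bump /= big_ord_recr mulnDl.
Qed.

Lemma binom3D_recl b : 'C(b.+1 + 3 * 0, 0) = 'C(b + 3 * 0, 0).
Proof. by rewrite !bin0. Qed.

Lemma binom3D_recS n b :
  'C(b.+1 + 3 * n.+1, n.+1) = 'C(b + 3 * n.+1, n.+1) + 'C(b.+3 + 3 * n, n).
Proof.
by rewrite addSn binS (_ : b.+3 + 3 * n = b + 3 * n.+1) //; lia.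
Qed.

Lemma B3_raney m : B3_coef m = raney m 1.
Proof.
have := raney_closed m 1; rewrite mul1n /B3_coef add1n => <-.
by rewrite mulKn.
Qed.

Lemma raney1_conv m :
  raney m.+1 1 = \sum_(i < m.+1) raney i 1 * raney (m - i) 2.
Proof.
rewrite (raney_conv (G := fun n b => raney n b)) //.
  by rewrite raneySS raney0r.
by move=> n b; apply: raneySS.
Qed.

Lemma raney2_conv m :
  raney m 2 = \sum_(i < m.+1) raney i 1 * raney (m - i) 1.
Proof.
rewrite (raney_conv (G := fun n b => raney n b)) // => n b.
exact: raneySS.
Qed.

(** The coefficients of [B S]. *)
Lemma binom3_conv m :
  'C(1 + 3 * m, m) = \sum_(i < m.+1) raney i 1 * 'C(3 * (m - i), m - i).
Proof.
rewrite -(raney_conv (G := fun n b => 'C(b + 3 * n, n)) _ _ m 1 0) //.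
  by move=> b; apply: binom3D_recl.
exact: binom3D_recS.
Qed.

(** Coefficientwise form of [3 S = 2 B S + B]. *)
Lemma binom3_raney m : 3 * 'C(3 * m, m) = 2 * 'C(1 + 3 * m, m) + raney m 1.
Proof.
have := raney_closed m 1; have := mul_bin_down (1 + 3 * m) m.
rewrite !mul1n !add1n /=.
have -> : (3 * m).+1 - m = (2 * m).+1 by lia.
move: ('C(_, _)) ('C(_, _)) (raney _ _) => c d r h1 h2.

have h3 : d = (2 * m).+1 * r.
  apply/eqP; rewrite -(eqn_pmul2l (isT : 0 < (3 * m).+1)); apply/eqP.
  by rewrite h1 -h2; ring.
by rewrite h3 -h2; ring.
Qed.

Local Open Scope ring_scope.

(** * Ultrametric absolute values *)

Section AbsoluteValue.
Variables (R : realType) (F : fieldType) (w : absval R F).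

Lemma absval0 : w 0 = 0. Proof. exact/absval_eq0. Qed.

Lemma absval_gt0 x : (0 < w x) = (x != 0).
Proof.
have [->|x0] := eqVneq x 0; first by rewrite absval0 ltxx.
by rewrite lt0r absval_ge0 andbT; apply: contraNN x0 => /eqP/absval_eq0 ->.
Qed.

Lemma absval1 : w 1 = 1.
Proof.
have w1 : w 1 != 0 by rewrite gt_eqF // absval_gt0 oner_neq0.
by apply: (mulfI w1); rewrite -absvalM !mulr1.
Qed.

Lemma absvalX x n : w (x ^+ n) = w x ^+ n.
Proof.
elim: n => [|n IHn]; first by rewrite !expr0 absval1.
by rewrite !exprS absvalM IHn.
Qed.

Lemma absvalN x : w (- x) = w x.
Proof.
have wN1 : w (-1) = 1.
  have /eqP := absvalX (-1) 2; rewrite sqrrN expr1n absval1 eq_sym sqrf_eq1.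
  case/orP=> /eqP // h; have := absval_ge0 w (-1); rewrite h.
  by rewrite ler0N1.
by rewrite -mulN1r absvalM wN1 mul1r.
Qed.

Lemma absval_distC x y : w (x - y) = w (y - x).
Proof. by rewrite -absvalN opprB. Qed.

Lemma absvalV x : w x^-1 = (w x)^-1.
Proof.
have [->|x0] := eqVneq x 0; first by rewrite invr0 absval0 invr0.
have wx0 : w x != 0 by rewrite gt_eqF // absval_gt0.
by apply: (mulfI wx0); rewrite -absvalM !divff // absval1.
Qed.

Lemma absval_div x y : w (x / y) = w x / w y.
Proof. by rewrite absvalM absvalV. Qed.

Lemma absval_sum (I : Type) (r : seq I) (f : I -> F) :
  w (\sum_(i <- r) f i) <= \sum_(i <- r) w (f i).
Proof.
elim/big_rec2: _ => [|i b a _ ab]; first by rewrite absval0.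
by apply: le_trans (absvalD _ _ _) _; rewrite lerD2l.
Qed.

(** The strong triangle inequality, phrased with a common bound [M] so that
    it chains by [apply] without introducing maxima. *)
Definition ultrametric :=
  forall x y (M : R), w x <= M -> w y <= M -> w (x + y) <= M.

(** Bernoulli gives [1 + n h <= t ^+ n] for [t = 1 + h]; squaring beats the
    linear bound at exponent [2 n] once [n > 2 / h^2]. *)
Lemma expr_linear_bound_le1 (t : R) :
  0 <= t -> (forall n, t ^+ n <= n.+1%:R) -> t <= 1.
Proof.
move=> t0 H; rewrite leNgt; apply/negP => t1.
pose h := t - 1; have h0 : 0 < h by rewrite subr_gt0.
have bern n : 1 + n%:R * h <= t ^+ n.
  elim: n => [|n IHn]; first by rewrite mul0r addr0.
  rewrite exprS -natr1; apply: le_trans (_ : t * (1 + n%:R * h) <= _); last first.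
    by rewrite ler_pM2l // (lt_trans ltr01).
  have : 0 <= n%:R :> R by [].
  by rewrite (_ : t = 1 + h); [nra | rewrite /h; ring].
pose n := (Num.truncn (2 / h ^+ 2)).+1.
have nlt : 2 / h ^+ 2 < n%:R by apply: truncnS_gt.
have n0 : 0 < n%:R :> R by rewrite ltr0n.
have /(_ (2 * n)%N) := H; rewrite mulnC exprM -natr1 natrM.
have b := bern n; move: nlt; rewrite ltr_pdivrMr ?exprn_gt0 // => nlt.
have : (1 + n%:R * h) ^+ 2 <= (t ^+ n) ^+ 2.
  by rewrite ler_sqr ?nnegrE ?exprn_ge0 // addr_ge0 // mulr_ge0 // ltW.
have : n%:R * 2 < n%:R * (n%:R * h ^+ 2) by rewrite ltr_pM2l.
have : 0 < n%:R * h by rewrite mulr_gt0.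
move: nlt n0; move: (n%:R : R) => m; nra.
Qed.

(** In the binomial expansion of [(x + y) ^+ n] each of the [n + 1] terms is
    at most [M ^+ n]; the factor [n + 1] disappears when taking [n]-th
    roots. *)
Lemma nonarchimedean_ultrametric : nonarchimedean w -> ultrametric.
Proof.
move=> na x y M xM yM.
have M0 : 0 <= M := le_trans (absval_ge0 w x) xM.
have bound n : w (x + y) ^+ n <= n.+1%:R * M ^+ n.
  rewrite -absvalX exprDn; apply: le_trans (absval_sum _ _) _.
  rewrite mulr_natl -[X in _ *+ X]card_ord -sumr_const; apply: ler_sum => i _.
  rewrite -mulr_natl !absvalM !absvalX -[leRHS]mul1r.
  apply: ler_pM; rewrite ?mulr_ge0 ?exprn_ge0 ?absval_ge0 //.
    exact: (na 'C(n, i)).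
  rewrite -[X in M ^+ X](subnK (leq_ord i)) exprD.
  by apply: ler_pM; rewrite ?exprn_ge0 ?absval_ge0 // lerXn2r // nnegrE absval_ge0.
have [M00|Mn0] := eqVneq M 0.
  by have := bound 1%N; rewrite M00 !expr1 mulr0.
have Mp : 0 < M by rewrite lt0r Mn0.
rewrite -[leRHS]mul1r -ler_pdivrMr //; apply: expr_linear_bound_le1.
  by rewrite divr_ge0 ?absval_ge0.
by move=> n; rewrite expr_div_n ler_pdivrMr ?exprn_gt0.
Qed.

Lemma ultrametricB x y (M : R) :
  ultrametric -> w x <= M -> w y <= M -> w (x - y) <= M.
Proof. by move=> um xM yM; apply: um; rewrite ?absvalN. Qed.

Lemma ultrametric_sum (I : eqType) (r : seq I) (f : I -> F) (M : R) :
  ultrametric -> 0 <= M -> (forall i, i \in r -> w (f i) <= M) ->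
  w (\sum_(i <- r) f i) <= M.
Proof.
move=> um M0 fM; rewrite big_seq; elim/big_ind: _ => //.
  by rewrite absval0.
by move=> x y; apply: um.
Qed.

Lemma ultrametric_dominated x y : ultrametric -> w y < w x -> w (x + y) = w x.
Proof.
move=> um yx; apply/le_anti/andP; split; first by apply: um => //; apply: ltW.
rewrite leNgt; apply/negP => xyx.
have : w x <= Num.max (w (x + y)) (w y).
  rewrite -{1}(addrK y x); apply: ultrametricB um _ _.
    by rewrite le_max lexx.
  by rewrite le_max lexx orbT.
by rewrite leNgt gt_max xyx yx.
Qed.

End AbsoluteValue.

(** * Power series with natural coefficients *)

Section IntegerPowerSeries.
Variables (R : realType) (C : fieldType) (v : absval R C).
Hypothesis v_na : nonarchimedean v.
Variable y : C.
Hypothesis y_lt1 : v y < 1.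

Let um : ultrametric v := nonarchimedean_ultrametric v_na.

Definition ev (P : {poly int}) : C := (map_poly intr P).[y].

(** Truncations are kept in [{poly int}]: the value at [y] of any integral
    polynomial has absolute value at most 1, which makes every error estimate
    below a statement about divisibility by a power of ['X]. *)
Definition trunc (a : nat -> nat) (N : nat) : {poly int} :=
  \poly_(n < N) (a n)%:R.

Lemma evD P Q : ev (P + Q) = ev P + ev Q.
Proof. by rewrite /ev rmorphD hornerD. Qed.

Lemma evB P Q : ev (P - Q) = ev P - ev Q.
Proof. by rewrite /ev rmorphB hornerD hornerN. Qed.

Lemma evM P Q : ev (P * Q) = ev P * ev Q.
Proof. by rewrite /ev rmorphM hornerM. Qed.

Lemma evXn n : ev 'X^n = y ^+ n.
Proof. by rewrite /ev map_polyXn hornerXn. Qed.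

Lemma absval_ev P : v (ev P) <= 1.
Proof.
rewrite /ev horner_coef; apply: ultrametric_sum => // i _.
rewrite absvalM absvalX coef_map /=.
by rewrite mulr_ile1 ?absval_ge0 ?exprn_ge0 ?exprn_ile1 ?absval_ge0 
  ?(ltW y_lt1) // v_na.
Qed.

Lemma absval_ev_tail N (P : {poly int}) :
  (forall n, (n < N)%N -> P`_n = 0) -> v (ev P) <= v y ^+ N.
Proof.
move=> P0; rewrite -(poly_take_drop N P).
have -> : take_poly N P = 0.
  by apply/polyP => i; rewrite coef_take_poly coef0; case: ifP => // /P0.
rewrite add0r evM evXn absvalM absvalX -[leRHS]mul1r.
by rewrite ler_wpM2r ?exprn_ge0 ?absval_ge0 ?absval_ev.
Qed.

Lemma ev_trunc a N : ev (trunc a N) = \sum_(n < N) (a n)%:R * y ^+ n.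
Proof.
rewrite /ev /trunc (horner_coef_wide _ (_ : _ <= N)%N); last first.
  by apply: leq_trans (size_poly _ _) (size_poly _ _).
apply: eq_bigr => i _; rewrite coef_map coef_poly ltn_ord /=.
by rewrite rmorph_nat.
Qed.

(** Convergence with the explicit rate that the ultrametric inequality
    provides; this form is stable under the operations below, without any
    limit argument. *)
Definition has_sum a l := forall N, v (l - ev (trunc a N)) <= v y ^+ N.

Lemma has_sum_le1 a l : has_sum a l -> v l <= 1.
Proof. by move=> /(_ 0); rewrite ev_trunc big_ord0 subr0 expr0. Qed.

Lemma powers_small (e : R) : 0 < e -> exists N, v y ^+ N < e.
Proof.
move=> e0; have y1 : `|v y| < 1 by rewrite ger0_norm ?absval_ge0.
have /cvgr0_norm_lt/(_ e e0) [N _ HN] := cvg_expr y1.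
by exists N; move: (HN N (leqnn N)); rewrite /= ger0_norm ?exprn_ge0 ?absval_ge0.
Qed.

Lemma has_sum_unique a l m : has_sum a l -> has_sum a m -> l = m.
Proof.
move=> al am; apply/eqP; rewrite -subr_eq0; apply/negPn/negP.
rewrite -(absval_gt0 v) => /powers_small [N]; rewrite ltNge => /negP; apply.
rewrite (_ : l - m = (l - ev (trunc a N)) - (m - ev (trunc a N))); last by ring.
exact: ultrametricB.
Qed.

Lemma trunc_cauchy a M N : (N <= M)%N ->
  v (ev (trunc a M) - ev (trunc a N)) <= v y ^+ N.
Proof.
move=> NM; rewrite -evB; apply: absval_ev_tail => n nN.
by rewrite coefB !coef_poly nN (leq_trans nN NM) subrr.
Qed.

Lemma has_sum_exists a : absval_complete v -> exists l, has_sum a l.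
Proof.
move=> v_complete.
have [e e0|l al] := v_complete (fun N => ev (trunc a N)).
  have [N yN] := powers_small e0; exists N => m n Nm Nn.
  apply: le_lt_trans yN; rewrite -(subrKA (ev (trunc a N))).
  by apply: um; last rewrite absval_distC; apply: trunc_cauchy.
exists l => N; apply/ler_addgt0Pr => e e0.
have /cvgr0_norm_lt/(_ e e0) [M _ HM] := al.
pose m := maxn M N.
rewrite -(subrKA (ev (trunc a m))); apply: um.
  have := HM m (leq_maxl _ _); rewrite /= ger0_norm ?absval_ge0 // absval_distC.
  by move=> /ltW le; apply: le_trans le _; rewrite lerDr exprn_ge0 ?absval_ge0.
apply: le_trans (trunc_cauchy a (leq_maxr M N)) _.
by rewrite lerDl ltW.
Qed.

Lemma has_sum_unconditional a l :
  has_sum a l -> unconditional_sum v (fun n => (a n)%:R * y ^+ n) l.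
Proof.
move=> al; have totallyF : ProperFilter (@totally nat) := totally_filter.
apply/cvgr0Pnorm_lt => e e0.
have [N yN] := powers_small e0.
exists [fset n in iota 0 N]%fset => // A /= NA.
rewrite ger0_norm ?absval_ge0 //; apply: le_lt_trans yN.
rewrite (big_fsetID _ (fun n => (n < N)%N)) /=.
have -> : \sum_(i <- [fset x | x in A & (x < N)%N]%fset)
    (a i)%:R * y ^+ i = ev (trunc a N).
  rewrite ev_trunc -(big_mkord xpredT (fun i => (a i)%:R * y ^+ i)).
  apply: perm_big; apply: uniq_perm; rewrite ?iota_uniq ?fset_uniq // => i.
  rewrite mem_index_iota !inE /= andbC; case: ltnP => //= iN.
  by apply: (fsubsetP NA); rewrite !inE mem_iota.
rewrite addrAC; apply: um; first by rewrite absval_distC.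
apply: ultrametric_sum; rewrite ?exprn_ge0 ?absval_ge0 // => i.
rewrite !inE /= -leqNgt => /andP[_ Ni].
rewrite absvalM absvalX -[leRHS]mul1r.
apply: ler_pM; rewrite ?absval_ge0 ?exprn_ge0 ?absval_ge0 //; first exact: (v_na (a i)).
by rewrite ler_wiXn2l ?absval_ge0 ?(ltW y_lt1).
Qed.

Lemma has_sumD a b l m :
  has_sum a l -> has_sum b m -> has_sum (fun n => a n + b n)%N (l + m).
Proof.
move=> al bm N.
have -> : trunc (fun n => a n + b n)%N N = trunc a N + trunc b N.
  by apply/polyP => i; rewrite coefD !coef_poly; case: ifP => //; rewrite ?addr0 ?natrD.
by rewrite evD opprD addrACA; apply: um.
Qed.

Lemma has_sum_shift a l :
  has_sum (fun n => a n.+1) l -> has_sum a ((a 0%N)%:R + y * l).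
Proof.
move=> al [|N].
  rewrite ev_trunc big_ord0 subr0; apply: um; first exact: (v_na (a 0%N)).
  by rewrite absvalM mulr_ile1 ?absval_ge0 ?(ltW y_lt1) ?(has_sum_le1 al).
have -> : ev (trunc a N.+1) = (a 0%N)%:R + y * ev (trunc (fun n => a n.+1) N).
  rewrite !ev_trunc big_ord_recl expr0 mulr1 mulr_sumr; congr (_ + _).
  by apply: eq_bigr => i _; rewrite exprS mulrCA.
rewrite opprD addrACA subrr add0r -mulrBr absvalM exprS.
by rewrite ler_wpM2l ?absval_ge0.
Qed.

(** The product of two truncations and the truncation of the Cauchy product
    agree below degree [N]. *)
Lemma has_sumM (a b c : nat -> nat) l m :
  (forall n, c n = \sum_(i < n.+1) a i * b (n - i))%N ->
  has_sum a l -> has_sum b m -> has_sum c (l * m).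
Proof.
move=> cE al bm N.
rewrite (_ : l * m - _ = (l - ev (trunc a N)) * m
     + (ev (trunc a N) * (m - ev (trunc b N))
     + ev (trunc a N * trunc b N - trunc c N))); last by rewrite evB evM; ring.
have y0 : 0 <= v y ^+ N by rewrite exprn_ge0 ?absval_ge0.
apply: um; last apply: um.
- rewrite absvalM -[leRHS]mulr1.
  by apply: ler_pM; rewrite ?absval_ge0 ?(has_sum_le1 bm).
- rewrite absvalM -[leRHS]mul1r.
  by apply: ler_pM; rewrite ?absval_ge0 ?absval_ev.
apply: absval_ev_tail => n nN; rewrite coefB coefM coef_poly nN cE natr_sum.
apply/eqP; rewrite subr_eq0; apply/eqP; apply: eq_bigr => i _.
rewrite !coef_poly (leq_ltn_trans (leq_ord i) nN).
by rewrite (leq_ltn_trans (leq_subr _ _) nN) natrM.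
Qed.

Lemma has_sum_dist0 a l : has_sum a l -> v (l - (a 0%N)%:R) <= v y.
Proof. by move=> /(_ 1%N); rewrite ev_trunc big_ord1 expr0 mulr1 expr1. Qed.

End IntegerPowerSeries.

(** * The trinomial and discriminant roots *)

Section RootsInBaseField.
Variables (R : realType) (C : fieldType) (v : absval R C).
Hypothesis v_na : nonarchimedean v.
Hypothesis v_complete : absval_complete v.

Let um : ultrametric v := nonarchimedean_ultrametric v_na.

Lemma B3_sum y : v y < 1 ->
  exists2 mu, has_sum v y B3_coef mu & mu = 1 + y * mu ^+ 3.
Proof.
move=> y1; have [mu] := has_sum_exists v_na y1 (raney^~ 1%N) v_complete.
move=> mu1; exists mu; first by rewrite (funext B3_raney).
have mu2 : has_sum v y (raney^~ 2) (mu * mu).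
  exact: (has_sumM v_na y1 raney2_conv mu1 mu1).
have mu3 : has_sum v y (fun n => raney n.+1 1) (mu * (mu * mu)).
  exact: (has_sumM v_na y1 (c := fun n => raney n.+1 1) raney1_conv mu1 mu2).
rewrite exprS expr2.
exact: (has_sum_unique v_na y1 mu1 (has_sum_shift v_na y1 (a := raney^~ 1%N) mu3)).
Qed.

(** Eliminate [mu = B(y)] between [lambda (3 - 2 mu) = mu] and
    [mu = 1 + y mu^3]. *)
Lemma binom3_sum y : v y < 1 ->
  exists2 lambda, has_sum v y (fun n => 'C(3 * n, n)) lambda
    & (4 - 27 * y) * lambda ^+ 3 = 3 * lambda + 1.
Proof.
move=> y1; have [mu muB muE] := B3_sum y1.
have mu1 : has_sum v y (raney^~ 1%N) mu by rewrite -(funext B3_raney).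
have [l ls] := has_sum_exists v_na y1 (fun n => 'C(3 * n, n)) v_complete.
exists l => //.
have d : has_sum v y (fun n => 'C(1 + 3 * n, n)) (mu * l).
  exact: (has_sumM v_na y1 (b := fun n => 'C(3 * n, n)) binom3_conv mu1 ls).
have lE : l + (l + l) = mu * l + (mu * l + mu).
  apply: (has_sum_unique v_na y1 (a := fun n => (3 * 'C(3 * n, n))%N)).
    rewrite (_ : (fun n => _) = (fun n => 'C(3 * n, n) +
        ('C(3 * n, n) + 'C(3 * n, n)))%N).
      by do 2!apply: has_sumD => //.
    by apply: funext => n; lia.
  rewrite (_ : (fun n => _) = (fun n => 'C(1 + 3 * n, n) +
      ('C(1 + 3 * n, n) + raney n 1))%N).
    by do 2!apply: has_sumD => //.
  by apply: funext => n; rewrite binom3_raney; lia.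
have lM : l * (3 - 2 * mu) = mu.
  by apply: (addrI (mu * l + mu * l)); rewrite -[RHS]addrA -lE; ring.
have mu0 : mu != 0.
  apply: contraTneq isT => mu0; move/eqP: muE.
  by rewrite mu0 expr0n mulr0 addr0 eq_sym oner_eq0.
have u0 : 3 - 2 * mu != 0.
  by apply: contraNneq mu0 => u0; rewrite -lM u0 mulr0.
have -> : l = mu / (3 - 2 * mu) by rewrite -{1}lM mulfK.
apply/eqP; rewrite -subr_eq0.
rewrite (_ : _ - _ = 27 * (mu - (1 + y * mu ^+ 3)) / (3 - 2 * mu) ^+ 3).
  by rewrite -muE subrr mulr0 mul0r.
by field.
Qed.

Lemma trinomial_root_exists p q : D_tri v (p, q) ->
  exists r, [/\ is_trinomial_root v p q r, r ^+ 3 + p * r + q = 0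
              & v r = v q / v p].
Proof.
move=> tri; have := tri; rewrite /D_tri /= => pq.
have p0 : p != 0.
  apply: contraTneq pq => ->.
  by rewrite absval0 expr0n -leNgt exprn_ge0 ?absval_ge0.
have vp0 : 0 < v p by rewrite absval_gt0.
have y1 : v (q ^+ 2 / (- p) ^+ 3) < 1.
  by rewrite absval_div !absvalX absvalN ltr_pdivrMr ?mul1r ?exprn_gt0.
have [mu muS muE] := B3_sum y1.
exists (- (q * mu) / p); split.
- by split=> //; exists mu => //; apply: has_sum_unconditional.
- rewrite (_ : _ + _ = q * (1 + q ^+ 2 / (- p) ^+ 3 * mu ^+ 3 - mu)).
    by rewrite -muE subrr mulr0.
  by field; rewrite oppr_eq0 p0.
have v_mu : v mu = 1.
  have := has_sum_dist0 muS; rewrite B3_raney /= => mu_1.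
  rewrite -(subrKC 1 mu) ultrametric_dominated ?absval1 //.
  exact: le_lt_trans mu_1 y1.
by rewrite absval_div absvalN absvalM v_mu mulr1.
Qed.

(** With [y = -Delta / (27 p^3)] one has [4 - 27 y = -27 q^2 / p^3].  The
    last estimate, that the root is close to [3 q / p], is what later singles
    it out among the three roots. *)
Lemma discriminant_root_exists p q : v 3 = 1 -> D_disc v (p, q) ->
  exists r, [/\ is_discriminant_root v p q r, r ^+ 3 + p * r + q = 0,
    v (- cubic_disc p q / (27 * p ^+ 3)) < 1
    & v (r - 3 * q / p) <= v (3 * q / p) * v (- cubic_disc p q / (27 * p ^+ 3))].
Proof.
move=> v3 disc; have := disc; rewrite /D_disc /= absvalM v3 mul1r => pq.
have p0 : p != 0.
  apply: contraTneq pq => ->.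
  by rewrite absval0 expr0n -leNgt; exact: absval_ge0.
have vp0 : 0 < v p by rewrite absval_gt0.
have E27 : 27 = 3 ^+ 3 :> C by ring.
have n27 : 27 != 0 :> C by rewrite -(absval_gt0 v) E27 absvalX v3 expr1n.
have y1 : v (- cubic_disc p q / (27 * p ^+ 3)) < 1.
  rewrite absval_div absvalM E27 !absvalX absvalN v3 expr1n mul1r.
  by rewrite ltr_pdivrMr ?mul1r ?exprn_gt0.
have [l lS lE] := binom3_sum y1.
exists (3 * q / p * l); split=> //.
- by split=> //; exists l => //; apply: has_sum_unconditional.
- rewrite (_ : _ + _ = - q * ((4 - 27 * (- cubic_disc p q / (27 * p ^+ 3)))
      * l ^+ 3 - (3 * l + 1))); first by rewrite lE subrr mulr0.
  by rewrite /cubic_disc; field; rewrite p0 n27.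
rewrite (_ : _ - _ = 3 * q / p * (l - 1)); last by rewrite mulrBr mulr1.
rewrite [leLHS]absvalM ler_wpM2l ?absval_ge0 //.
by have := has_sum_dist0 lS; rewrite muln0 bin0.
Qed.

End RootsInBaseField.

(** * Triples of roots *)

Section Roots.

Lemma ord3P (i j k : 'I_3) : i != j -> i != k -> j != k ->
  forall l, [\/ l = i, l = j | l = k].
Proof.
move=> ij ik jk l.
have [->|li] := eqVneq l i; first by constructor 1.
have [->|lj] := eqVneq l j; first by constructor 2.
constructor 3; apply/val_inj; move: ij ik jk li lj.
rewrite -!val_eqE /=.
have := ltn_ord i; have := ltn_ord j; have := ltn_ord k; have := ltn_ord l.
by lia.
Qed.

Lemma ord3_others (i : 'I_3) : [/\ i != i + 1, i != i + 2 & i + 1 != i + 2].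
Proof. by case: i => [[|[|[|//]]] Hi]. Qed.

Lemma ord3_cyclic (i j k : 'I_3) : i != j -> i != k -> j != k ->
  (j = i + 1 /\ k = i + 2) \/ (j = i + 2 /\ k = i + 1).
Proof.
have [i1 i2 i12] := ord3_others i.
move=> ij ik jk; case: (ord3P i1 i2 i12 j) => jE; first by rewrite jE eqxx in ij.
  case: (ord3P i1 i2 i12 k) => kE; first by rewrite kE eqxx in ik.
    by rewrite jE kE eqxx in jk.
  by left.
case: (ord3P i1 i2 i12 k) => kE; first by rewrite kE eqxx in ik.
  by right.
by rewrite jE kE eqxx in jk.
Qed.

Lemma ord3_third (i j : 'I_3) : i != j -> exists k, k != i /\ k != j.
Proof.
move=> ij; have [i1 i2 i12] := ord3_others i.
have [->|j1] := eqVneq j (i + 1).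
  by exists (i + 2); rewrite eq_sym i2 eq_sym.
by exists (i + 1); rewrite eq_sym i1 eq_sym.
Qed.

Lemma prod_ord3 (S : comNzRingType) (f : 'I_3 -> S) (i j k : 'I_3) :
  i != j -> i != k -> j != k -> \prod_(l < 3) f l = f i * f j * f k.
Proof.
move=> ij ik jk; rewrite (bigD1 i) //= (bigD1 j) 1?eq_sym //=.
rewrite (bigD1 k) /= 1?eq_sym ?ik 1?eq_sym ?jk //= big1 ?mulr1 ?mulrA // => l.
by case: (ord3P ij ik jk l) => ->; rewrite eqxx ?andbF.
Qed.

Variables (C : fieldType) (K : closedFieldType) (iota : {rmorphism C -> K}).
Variables (p q : C) (x : 'I_3 -> K).
Hypothesis x_roots : roots_of_cubic iota p q x.

Lemma vieta (i j k : 'I_3) : i != j -> i != k -> j != k ->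
  [/\ x i + x j + x k = 0, iota p = x i * x j + x j * x k + x k * x i
    & iota q = - (x i * x j * x k)].
Proof.
move=> ij ik jk; have := x_roots; rewrite /roots_of_cubic (prod_ord3 _ ij ik jk).
move: (x i) (x j) (x k) => a b c.
rewrite (_ : _ * _ * _ = 'X^3 - (a + b + c) *: 'X^2
   + (a * b + b * c + c * a) *: 'X - (a * b * c)%:P); last first.
  by rewrite -!mul_polyC !(rmorphD, rmorphM) /=; ring.
rewrite /cubic 2!rmorphD /= map_polyXn map_polyZ map_polyX map_polyC => E.
have c2 := congr1 (fun P : {poly K} => P`_2) E.
have c1 := congr1 (fun P : {poly K} => P`_1) E.
have c0 := congr1 (fun P : {poly K} => P`_0) E.
move: c2 c1 c0; rewrite !coefE /= !(mulr0, mulr1, addr0, add0r, subr0, oppr0) => c2 -> ->.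
by split=> //; apply/eqP; rewrite -oppr_eq0 -c2.
Qed.

Lemma root_of_cubic r : r ^+ 3 + p * r + q = 0 -> exists i, x i = iota r.
Proof.
move=> r0; have : (map_poly iota (cubic p q)).[iota r] = 0.
  rewrite horner_map /cubic !hornerE.
  by rewrite r0 rmorph0.
rewrite x_roots horner_prod => /eqP/prodf_eq0[i _].
rewrite !hornerE subr_eq0 => /eqP ->.
by exists i.
Qed.

End Roots.

(** * Lengths of the roots *)

Lemma powR_root (R : realType) (n : nat) (a : R) :
  (0 < n)%N -> 0 <= a -> (a ^+ n) `^ n%:R^-1 = a.
Proof.
move=> n0 a0; rewrite -powR_mulrn // -powRrM mulfV ?pnatr_eq0 -?lt0n //.
by rewrite powRr1.
Qed.

Section Lengths.
Variables (R : realType) (C : fieldType) (K : closedFieldType).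
Variables (iota : {rmorphism C -> K}) (w : absval R K) (um : ultrametric w).
Variables (p q : C) (x : 'I_3 -> K).
Hypothesis x_roots : roots_of_cubic iota p q x.

Lemma isosceles (a b c : K) : a + b + c = 0 -> w a < w b -> w c = w b.
Proof.
move=> abc ab; rewrite -(ultrametric_dominated um ab) -absvalN.
by rewrite (_ : - c = b + a - (a + b + c)); [rewrite abc subr0 | ring].
Qed.

(** Take a root of minimal length: if another root is strictly longer, the
    isosceles property forces both others to have that same length. *)
Lemma shortest_or_equal :
  has_shortest_root w x \/ (forall i j, w (x i) = w (x j)).
Proof.
have [i _ imin] := @arg_minP _ _ _ (ord0 : 'I_3) xpredT (fun i => w (x i)) isT.
have {}imin j : w (x i) <= w (x j) by apply: imin.
have [[m im]|eq_i] := pselect (exists m, w (x i) < w (x m)); last first.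
  right; suff H j : w (x j) = w (x i) by move=> j k; rewrite !H.
  by apply: le_anti; rewrite imin andbT leNgt; apply/negP => ?; apply: eq_i; exists j.
left; exists i => j k ij ik jk.
have [s _ _] := vieta x_roots ij ik jk.
have := imin j; rewrite le_eqVlt => /orP[/eqP eij|lij]; last first.
  by rewrite (isosceles s lij).
have := imin k; rewrite le_eqVlt => /orP[/eqP eik|lik].
  by case: (ord3P ij ik jk m) => mE; move: im; rewrite mE -?eij -?eik ltxx.
have s' : x i + x k + x j = 0 by rewrite -s addrAC.
by have := lik; rewrite -(isosceles s' lik) eij ltxx.
Qed.

Lemma shortest_root_coefs i j k : i != j -> i != k -> j != k ->
  shortest_root w x i ->
  w (iota p) = w (x j) ^+ 2 /\ w (iota q) = w (x i) * w (x j) ^+ 2.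
Proof.
move=> ij ik jk /(_ j k ij ik jk) [jkE lij].
have [s -> ->] := vieta x_roots ij ik jk.
split; last by rewrite absvalN !absvalM -jkE; ring.
have xi : x i = - (x j + x k) by apply/eqP; rewrite -addr_eq0 addrA s.
have jkM : w (x j * x k) = w (x j) ^+ 2 by rewrite absvalM -jkE.
rewrite (_ : _ + _ = x j * x k - x i ^+ 2); last by rewrite xi; ring.
rewrite ultrametric_dominated // absvalN absvalX jkM.
by rewrite ltr_sqr ?nnegrE ?absval_ge0.
Qed.

Lemma shortest_root_lengths i : shortest_root w x i ->
  [/\ w (iota q) ^+ 2 < w (iota p) ^+ 3,
      w (x i) = w (iota q) / w (iota p),
      w (iota q) / w (iota p) < w (iota p) `^ 2^-1
    & forall j, j != i -> w (x j) = w (iota p) `^ 2^-1].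
Proof.
move=> short; have [ij ik jk] := ord3_others i.
have [jkE lij] := short _ _ ij ik jk.
have [-> ->] := shortest_root_coefs ij ik jk short.
have a0 := absval_ge0 w (x i).
have b0 : 0 < w (x (i + 1)) by apply: le_lt_trans lij.
rewrite powR_root ?(ltW b0) // mulfK ?gt_eqF ?exprn_gt0 //.
split=> //.
  rewrite exprMn -!exprM (_ : (2 * 3 = 2 + 2 * 2)%N) // exprD.
  by rewrite ltr_pM2r ?exprn_gt0 // ltr_sqr ?nnegrE ?(ltW b0).
move=> j; case: (ord3P ij ik jk j) => -> //; by rewrite eqxx.
Qed.

Lemma equal_lengths : (forall i j, w (x i) = w (x j)) ->
  w (iota p) ^+ 3 <= w (iota q) ^+ 2 /\ forall i, w (x i) = w (iota q) `^ 3^-1.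
Proof.
move=> eq; have qE i : w (iota q) = w (x i) ^+ 3.
  have [ij ik jk] := ord3_others i; have [_ _ ->] := vieta x_roots ij ik jk.
  by rewrite absvalN !absvalM -!(eq i); ring.
split=> [|i]; last by rewrite (qE i) powR_root ?absval_ge0.
pose i : 'I_3 := 0; have [ij ik jk] := ord3_others i.
rewrite (qE i) -exprM mulnC exprM lerXn2r ?nnegrE ?exprn_ge0 ?absval_ge0 //.
have [_ -> _] := vieta x_roots ij ik jk.
by apply: um; [apply: um|]; rewrite absvalM -!(eq i) -expr2.
Qed.

Lemma has_shortest_rootE :
  has_shortest_root w x <-> w (iota q) ^+ 2 < w (iota p) ^+ 3.
Proof.
split=> [[i /shortest_root_lengths[]//]|]; rewrite ltNge => lt.
by have [//|/equal_lengths[]] := shortest_or_equal; rewrite (negPf lt).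
Qed.

Lemma no_shortest_root_equal : ~ has_shortest_root w x ->
  forall i j, w (x i) = w (x j).
Proof. by have [|] := shortest_or_equal. Qed.

End Lengths.

(** * Distances between the roots *)

Section Sides.
Variables (R : realType) (K : closedFieldType) (w : absval R K).

(** Index arithmetic in ['I_3] is cyclic, so this is the difference of the
    two roots other than [x i], oriented so that the three sides sum to
    zero. *)
Definition side (x : 'I_3 -> K) (i : 'I_3) : K := x (i + 1) - x (i + 2).

Lemma side_length x i j k : i != j -> i != k -> j != k ->
  w (side x i) = w (x j - x k).
Proof.
by move=> ij ik jk; case: (ord3_cyclic ij ik jk) => -[-> ->] //; apply: absval_distC.
Qed.

Lemma isolated_root_side x i : isolated_root w x i <-> shortest_root w (side x) i.
Proof.
have sides j k : i != j -> i != k -> j != k ->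
    [/\ w (side x i) = w (x j - x k), w (side x j) = w (x i - x k)
      & w (side x k) = w (x i - x j)].
  by move=> ij ik jk; split; apply: side_length; rewrite // eq_sym.
split=> H j k ij ik jk; have := H j k ij ik jk.
  by have [-> -> ->] := sides j k ij ik jk; case=> -> ->.
by have [-> -> ->] := sides j k ij ik jk; case=> -> ->.
Qed.

Variables (C : fieldType) (iota : {rmorphism C -> K}) (p q : C) (x : 'I_3 -> K).
Hypothesis x_roots : roots_of_cubic iota p q x.

(** The square of the product of the differences is the discriminant, so the
    choice of the square root [s] is that of an orientation. *)
Lemma sides_of_cubic : exists2 s : K,
  roots_of_cubic (idfun : {rmorphism K -> K}) (iota (3 * p)) s (side x)
  & s ^+ 2 = iota (cubic_disc p q).
Proof.
have [ij ik jk] := ord3_others 0; have [s0 pE qE] := vieta x_roots ij ik jk.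
have S0 : side x 0 = x (0 + 1) - x (0 + 2) by [].
have S1 : side x (0 + 1) = x (0 + 2) - x 0.
  by congr (x _ - x _); apply: val_inj.
have S2 : side x (0 + 2) = x 0 - x (0 + 1).
  by congr (x _ - x _); apply: val_inj.
have x2 : x (0 + 2) = - (x 0 + x (0 + 1)).
  by apply/eqP; rewrite -addr_eq0 addrC s0.
have prodE : \prod_(l < 3) ('X - (side x l)%:P) = ('X - (side x 0)%:P) *
   ('X - (side x (0 + 1))%:P) * ('X - (side x (0 + 2))%:P).
  exact: (prod_ord3 (fun l => 'X - (side x l)%:P) ij ik jk).
exists (- (side x 0 * side x (0 + 1) * side x (0 + 2))).
  rewrite /roots_of_cubic prodE.
  rewrite (map_poly_id (g := idfun)); last by [].
  rewrite /cubic rmorphM rmorph_nat pE S0 S1 S2 x2.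
  move: (x 0) (x (0 + 1)) => a b.
  by rewrite -!mul_polyC !(polyCB, polyCD, polyCM, polyCN); ring.
rewrite /cubic_disc rmorphB rmorphN (rmorphM _ 4) (rmorphM _ 27)
  2!rmorphXn 2!rmorph_nat pE qE S0 S1 S2 x2.
move: (x 0) (x (0 + 1)) => a b; ring.
Qed.

End Sides.

(** * Identification of the roots *)

Lemma ultrametric_lt (R : realType) (F : fieldType) (w : absval R F) x y (d : R) :
  ultrametric w -> w x < d -> w y < d -> w (x + y) < d.
Proof.
move=> um xd yd; apply: (@le_lt_trans _ _ (Num.max (w x) (w y))).
  by apply: um; rewrite le_max lexx ?orbT.
by rewrite gt_max xd yd.
Qed.

Section Identification.
Variables (R : realType) (C : fieldType) (v : absval R C).
Hypothesis v_na : nonarchimedean v.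
Hypothesis v_complete : absval_complete v.
Hypothesis v3 : v 3 = 1.
Variables (K : closedFieldType) (iota : {rmorphism C -> K}) (w : absval R K).
Hypothesis w_ext : forall a, w (iota a) = v a.
Variables (p q : C) (x : 'I_3 -> K).
Hypothesis x_roots : roots_of_cubic iota p q x.

Lemma extension_ultrametric : ultrametric w.
Proof.
apply: nonarchimedean_ultrametric => n.
by rewrite -(rmorph_int iota) w_ext.
Qed.
Let um := extension_ultrametric.

Lemma extension_natr n : w n%:R = v n%:R.
Proof. by rewrite -(rmorph_nat iota) w_ext. Qed.

Lemma has_shortest_root_tri : has_shortest_root w x <-> D_tri v (p, q).
Proof. by rewrite (has_shortest_rootE um x_roots) !w_ext. Qed.

Lemma shortest_root_trinomial i : shortest_root w x i ->
  exists2 r, is_trinomial_root v p q r & x i = iota r.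
Proof.
move=> short; have tri : D_tri v (p, q) by apply/has_shortest_root_tri; exists i.
have [r [r_tri r0 rE]] := trinomial_root_exists v_na v_complete tri.
have [j xj] := root_of_cubic x_roots r0.
exists r => //; rewrite -xj; congr x.
apply: contraTeq isT; rewrite eq_sym => ji.
have [_ _ lt others] := shortest_root_lengths um x_roots short.
by move: lt; rewrite -(others j ji) xj !w_ext rE ltxx.
Qed.

Lemma extension_sqrt_disc s : s ^+ 2 = iota (cubic_disc p q) ->
  w s = v (cubic_disc p q) `^ 2^-1.
Proof. by move=> sE; rewrite -w_ext -sE absvalX powR_root ?absval_ge0. Qed.

Lemma extension_3p : w (iota (3 * p)) = v p.
Proof. by rewrite w_ext absvalM v3 mul1r. Qed.

Lemma has_isolated_rootE : has_isolated_root w x <-> D_disc v (p, q).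
Proof.
have [s s_roots sE] := sides_of_cubic x_roots.
have := has_shortest_rootE um s_roots; rewrite /= -absvalX sE !w_ext => disc.
apply: iff_trans disc.
by split=> -[i /isolated_root_side]; exists i; rewrite // -isolated_root_side.
Qed.

Lemma isolated_root_lengths i : isolated_root w x i ->
  [/\ forall j, j != i -> w (x i - x j) = v p `^ 2^-1,
      forall j k, j != i -> k != i -> j != k ->
        w (x j - x k) = v (cubic_disc p q) `^ 2^-1 / v p
    & v (cubic_disc p q) `^ 2^-1 / v p < v p `^ 2^-1].
Proof.
have [s s_roots sE] := sides_of_cubic x_roots.
move=> /isolated_root_side /(shortest_root_lengths um s_roots) /=.
rewrite extension_3p (extension_sqrt_disc sE) => -[_ short lt others].
split=> // [j ji|j k ji ki jk]; last first.
  by rewrite -short; apply/esym/side_length; rewrite // eq_sym.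
have [k [kj ki]] := ord3_third ji.
by rewrite -(others k ki) (@side_length _ _ _ _ k i j) // eq_sym.
Qed.

(** If the discriminant root were some [x j] with [j != i], it would be at
    distance [d = |x i - x j|] from the isolated root [x i]; but both are at
    distance less than [d] from [3 q / p]. *)
Lemma isolated_root_discriminant i : isolated_root w x i ->
  exists2 r, is_discriminant_root v p q r & x i = iota r.
Proof.
move=> iso; have disc : D_disc v (p, q) by apply/has_isolated_rootE; exists i.
have [r [r_disc r0 y1 r_near]] := discriminant_root_exists v_na v_complete v3 disc.
have [j xj] := root_of_cubic x_roots r0.
exists r => //; rewrite -xj; congr x.
apply: contraTeq isT => ij.
have [k [ki kj]] := ord3_third ij.
have [ik jk] : i != k /\ j != k by rewrite !(eq_sym _ k).
have [dE lt] := iso j k ij ik jk.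
have [s0 pE qE] := vieta x_roots ij ik jk.
pose d := w (x i - x j); pose e := w (x j - x k).
have e0 : 0 <= e by apply: absval_ge0.
have d0 : 0 < d by apply: le_lt_trans lt.
have pd : w (iota p) = d ^+ 2.
  have [s s_roots sE] := sides_of_cubic x_roots.
  move/isolated_root_side: iso.
  move=> /(shortest_root_coefs um s_roots ij ik jk)[/= + _].
  by rewrite extension_3p w_ext (@side_length _ _ _ _ j i k) 1?eq_sym // -dE.
have p0 : iota p != 0 by rewrite -(absval_gt0 w) pd exprn_gt0.
have xi_d : w (x i) <= d.
  have -> : w (x i) = w (3 * x i) by rewrite absvalM extension_natr v3 mul1r.
  rewrite (_ : 3 * x i = (x i - x j) + (x i - x k)).
    by apply: um; rewrite // -dE.
  by apply/eqP; rewrite -subr_eq0 -s0; apply/eqP; ring.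
(* [3 q / p - x i = x i * (x j - x k)^2 / p], and [|p| = d^2]. *)
have near : w (iota (3 * q / p) - x i) < d.
  rewrite (_ : _ - _ = x i * (x j - x k) ^+ 2 / iota p).
    rewrite absval_div pd ltr_pdivrMr ?exprn_gt0 // absvalM absvalX.
    apply: le_lt_trans (_ : d * e ^+ 2 < _); first by rewrite ler_wpM2r ?exprn_ge0.
    by rewrite ltr_pM2l // ltr_sqr ?nnegrE ?(ltW d0).
  have xk : x k = - (x i + x j) by apply/eqP; rewrite -addr_eq0 addrC s0.
  rewrite fmorph_div rmorphM rmorph_nat -[X in _ - X](mulfK p0) -mulrBl.
  by congr (_ / _); rewrite pE qE xk; ring.
have q_d : v (3 * q / p) <= d.
  rewrite -w_ext -(subrK (x i) (iota _)); apply: um => //; exact: ltW.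
have : w (iota r - x i) < d.
  rewrite (_ : _ - _ = iota (r - 3 * q / p) + (iota (3 * q / p) - x i)); last first.
    by rewrite rmorphB addrA subrK.
  apply: ultrametric_lt => //; rewrite w_ext; apply: le_lt_trans r_near _.
  apply: le_lt_trans (_ : d * v (- cubic_disc p q / (27 * p ^+ 3)) < _).
    by rewrite ler_wpM2r ?absval_ge0.
  by rewrite gtr_pMr.
by rewrite -xj absval_distC ltxx.
Qed.

Lemma equal_sides : ~ has_isolated_root w x -> forall i j k l, i != j -> k != l ->
  w (x i - x j) = w (x k - x l).
Proof.
move=> no_iso i j k l ij kl.
have [s s_roots _] := sides_of_cubic x_roots.
have eq : forall i j, w (side x i) = w (side x j).
  apply: (no_shortest_root_equal um s_roots) => -[m].
  by move=> /isolated_root_side m_iso; apply: no_iso; exists m.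
have [m [mi mj]] := ord3_third ij; have [n [nk nl]] := ord3_third kl.
by rewrite -(side_length _ _ mi mj ij) -(side_length _ _ nk nl kl).
Qed.

Lemma shortest_dist i j : i != j -> shortest_root w x i -> w (x i - x j) = w (x j).
Proof.
move=> ij short; have [k [ki kj]] := ord3_third ij.
rewrite eq_sym in ki; rewrite eq_sym in kj; have [_ lt] := short j k ij ki kj.
by rewrite absval_distC ultrametric_dominated // absvalN.
Qed.

Lemma opposite_side_identities i j k : i != j -> i != k -> j != k -> 
  x j - x k = 2 * x j + x i /\ x j - x k = 3 * x i - 2 * (x i - x j).
Proof.
move=> ij ik jk; have [s0 _ _] := vieta x_roots ij ik jk.
have -> : x k = - (x i + x j) by apply/eqP; rewrite -addr_eq0 addrC s0.
by split; ring.
Qed.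

(** For the shortest root [a], the identity [b - c = 2 b + a] gives the side
    opposite to it the same length as the other two. *)
Lemma shortest_not_isolated i j :
  v 2 = 1 -> shortest_root w x i -> ~ isolated_root w x j.
Proof.
move=> v2 short iso.
have eqB : forall k l, k != l -> w (x k - x l) = v p `^ 2^-1.
  move=> k l kl.
  have [_ _ _] := shortest_root_lengths um x_roots short; rewrite w_ext => others.
  have [ki|ki] := eqVneq k i.
    by rewrite ki in kl *; rewrite shortest_dist // others // eq_sym.
  have [li|li] := eqVneq l i.
    by rewrite absval_distC li shortest_dist 1?eq_sym // others.
  have [ik il] : i != k /\ i != l by rewrite !(eq_sym i).
  have [-> _] := opposite_side_identities ik il kl; have [_ lt] := short k l ik il kl.
  by rewrite ultrametric_dominated // absvalM extension_natr v2 mul1r // others.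
have [ij ik jk] := ord3_others j.
have [_] := iso _ _ ij ik jk.
by rewrite !eqB // ltxx.
Qed.

(** For a shortest root [a] the opposite side [2 b + a] is shorter than
    [b]; for an isolated root [a], [3 a = 2 (a - b) + (b - c)] is shorter than
    [a - b], so that [b] and [c] have the length of [a - b]. *)
Lemma shortest_isolated i : v 2 < 1 -> shortest_root w x i <-> isolated_root w x i.
Proof.
move=> v2; split=> [short|iso] j k ij ik jk.
  have [jkE lt] := short j k ij ik jk.
  rewrite (shortest_dist ij short) (shortest_dist ik short); split=> //.
  have [-> _] := opposite_side_identities ij ik jk.
  apply: ultrametric_lt => //; rewrite absvalM extension_natr gtr_pMl //.
  exact: le_lt_trans (absval_ge0 _ _) lt.
have [dE lt] := iso j k ij ik jk.
have lt_i : w (x i) < w (x i - x j).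
  have -> : w (x i) = w (3 * x i) by rewrite absvalM extension_natr v3 mul1r.
  have [_ jkE] := opposite_side_identities ij ik jk.
  rewrite (_ : 3 * x i = x j - x k + 2 * (x i - x j)); last by rewrite jkE subrK.
  apply: ultrametric_lt => //; rewrite absvalM extension_natr gtr_pMl //.
  exact: le_lt_trans (absval_ge0 _ _) lt.
have dist m : w (x i) < w (x i - x m) -> w (x m) = w (x i - x m).
  rewrite absval_distC => im.
  by rewrite -{1}(subrK (x i) (x m)) ultrametric_dominated.
by rewrite (dist j) // (dist k) -?dE.
Qed.

Lemma isolated_root_unique i j : isolated_root w x i -> isolated_root w x j -> i = j.
Proof.
move=> iso_i iso_j; apply: contraTeq isT => ij.
have [k [ki kj]] := ord3_third ij.
have [ik jk ji] : [/\ i != k, j != k & j != i] by rewrite !(eq_sym _ k) (eq_sym j).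
have [dE _] := iso_i j k ij ik jk; have [_ lt] := iso_j i k ji jk ik.
by move: lt; rewrite -dE absval_distC ltxx.
Qed.

End Identification.

(** * Examples: [t^3 - 3 t + 2] and [t^3 - t] *)

Section Examples.
Variables (R : realType) (C : fieldType) (K : closedFieldType).
Variables (iota : {rmorphism C -> K}) (w : absval R K).

Lemma isolated_root_example : w 3 = 1 -> exists p q x,
  roots_of_cubic iota p q x /\ has_isolated_root w x.
Proof.
move=> w3; pose x (i : 'I_3) : K := if i == 0 then -2 else 1.
exists (-3), 2, x; split.
  have [ij ik jk] := ord3_others 0.
  rewrite /roots_of_cubic (prod_ord3 _ ij ik jk) /x /cubic /=.
  rewrite 2!rmorphD /= map_polyXn map_polyZ map_polyX map_polyC /=.
  rewrite rmorphN !rmorph_nat -!mul_polyC !(polyCN, polyCMn); ring.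
exists 0 => j k; rewrite /x !(eq_sym 0) => /negPf -> /negPf -> _ /=.
split=> //; rewrite subrr absval0 (_ : -2 - 1 = - 3); last by ring.
by rewrite absvalN w3.
Qed.

Lemma shortest_root_example : exists p q x,
  roots_of_cubic iota p q x /\ has_shortest_root w x.
Proof.
pose x (i : 'I_3) : K := if i == 0 then 0 else if i == 1 then 1 else -1.
exists (-1), 0, x; split.
  have [ij ik jk] := ord3_others 0.
  rewrite /roots_of_cubic (prod_ord3 _ ij ik jk) /x /cubic /=.
  rewrite 2!rmorphD /= map_polyXn map_polyZ map_polyX map_polyC /=.
  rewrite rmorphN rmorph0 rmorph1 -!mul_polyC !(polyCN, polyCMn); ring.
have w_x m : m != 0 -> w (x m) = 1.
  by rewrite /x => /negPf ->; case: ifP; rewrite ?absvalN absval1.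
exists 0 => j k; rewrite !(eq_sym 0) => /w_x -> /w_x -> _.
by rewrite /x /= absval0.
Qed.
End Examples.

Theorem theorem34 (R : realType) (C : fieldType) (v : absval R C)
    (v_na : nonarchimedean v) (v_complete : absval_complete v)
    (v3 : v 3 = 1)
    (K : closedFieldType) (iota : {rmorphism C -> K})
    (K_alg : algebraic_closure iota)
    (w : absval R K) (w_ext : forall a : C, w (iota a) = v a)
    (p q : C) (x : 'I_3 -> K) (x_roots : roots_of_cubic iota p q x) :
  (* (a) *)
  ((has_shortest_root w x <-> D_tri v (p, q)) /\
   (forall i, shortest_root w x i ->
      [/\ exists2 r : C, is_trinomial_root v p q r & x i = iota r,
          w (x i) = v q / v p,
          v q / v p < v p `^ 2^-1
        & forall j, j != i -> w (x j) = v p `^ 2^-1])) /\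
  (* (b) *)
  (~ has_shortest_root w x -> forall i, w (x i) = v q `^ 3^-1) /\
  (* (c) *)
  ((has_isolated_root w x <-> D_disc v (p, q)) /\
   (forall i, isolated_root w x i ->
      [/\ exists2 r : C, is_discriminant_root v p q r & x i = iota r,
          forall j, j != i -> w (x i - x j) = v p `^ 2^-1,
          forall j k, j != i -> k != i -> j != k ->
            w (x j - x k) = v (cubic_disc p q) `^ 2^-1 / v p
        & v (cubic_disc p q) `^ 2^-1 / v p < v p `^ 2^-1])) /\
  (* (d) *)
  (~ has_isolated_root w x -> forall i j, i != j ->
     (D_tri v (p, q) -> w (x i - x j) = v p `^ 2^-1) /\
     (~ D_tri v (p, q) -> w (x i - x j) = v q `^ 3^-1)) /\
  (* (e) *)
  (v 2 = 1 ->
     [/\ exists (p' q' : C) (x' : 'I_3 -> K),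
           roots_of_cubic iota p' q' x' /\ has_isolated_root w x',
         exists (p' q' : C) (x' : 'I_3 -> K),
           roots_of_cubic iota p' q' x' /\ has_shortest_root w x'
       & ~ (has_isolated_root w x /\ has_shortest_root w x)]) /\
  (* (f) *)
  (v 2 < 1 ->
     (has_shortest_root w x <-> has_isolated_root w x) /\
     (forall i j, shortest_root w x i -> isolated_root w x j ->
        x i = x j /\
        exists r : C, [/\ is_trinomial_root v p q r,
                          is_discriminant_root v p q r & x i = iota r])).
Proof.
have um := extension_ultrametric v_na w_ext.
have w3 : w 3 = 1 by rewrite (extension_natr w_ext) v3.
have tri_iff := has_shortest_root_tri v_na w_ext x_roots.
have tri_root i := shortest_root_trinomial v_na v_complete w_ext x_roots (i := i).
have disc_iff := has_isolated_rootE v_na w_ext x_roots.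
have disc_root i := isolated_root_discriminant v_na v_complete v3 w_ext x_roots (i := i).
have lengths i := shortest_root_lengths um x_roots (i := i).
rewrite !w_ext in lengths.
have equal : ~ has_shortest_root w x ->
    (forall i j, w (x i) = w (x j)) /\ forall i, w (x i) = v q `^ 3^-1.
  move=> no; have eq := no_shortest_root_equal um x_roots no; split=> //.
  by have [_] := equal_lengths um x_roots eq; rewrite w_ext.
have sides := equal_sides v_na w_ext x_roots.
split; first split=> //.
  by move=> i short; have [_ ? ? ?] := lengths i short; split=> //; apply: tri_root.
split; first by move=> /equal[].
split; first split=> //.
  move=> i iso; have [? ? ?] := isolated_root_lengths v_na v3 w_ext x_roots iso.
  by split=> //; apply: disc_root.
split.
  move=> no_iso i j ij; split=> [/tri_iff[k short]|ntri].
    have [kl _ _] := ord3_others k.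
    rewrite (sides no_iso i j k (k + 1) ij kl).
    rewrite (shortest_dist v_na w_ext kl short).
    by have [_ _ _ ->] := lengths k short; rewrite // eq_sym.
  have [eq qE] := equal (fun short => ntri (tri_iff.1 short)); rewrite -(qE i).
  have {}eq k : w (x k) = w (x i) by apply: eq.
  apply: le_anti; apply/andP; split; first by apply: ultrametricB um _ _; rewrite ?(eq j).
  have [k [ki kj]] := ord3_third ij.
  have [ik jk] : i != k /\ j != k by rewrite !(eq_sym _ k).
  have -> : w (x i) = w (3 * x i) by rewrite absvalM w3 mul1r.
  have [s0 _ _] := vieta x_roots ij ik jk.
  rewrite (_ : 3 * x i = (x i - x j) + (x i - x k)).
    by apply: um => //; rewrite (sides no_iso i k i j ik ij).
  by apply/eqP; rewrite -subr_eq0 -s0; apply/eqP; ring.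
split.
  move=> v2; split.
  - have [p' [q' [x' h]]] := isolated_root_example iota w3.
    by exists p', q', x'.
  - have [p' [q' [x' h]]] := shortest_root_example iota w.
    by exists p', q', x'.
  by case=> -[i iso] [j short]; apply: (shortest_not_isolated v_na w_ext x_roots v2 short iso).
move=> v2; have short_iso i := shortest_isolated v_na v3 w_ext x_roots i v2.
split; first by split=> -[i /short_iso]; exists i.
move=> i j short iso; have iso_i := (short_iso i).1 short.
have ij : i = j := isolated_root_unique iso_i iso.
split; first by rewrite ij.
have [r r_tri xr] := tri_root i short; have [r' r_disc xr'] := disc_root i iso_i.
exists r; split=> //; rewrite (_ : r = r') //.
by apply: (fmorph_inj iota); rewrite -xr.
Qed.
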